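(* Every strong tournament on $n$ vertices has at most $1.6740^n$ maximal transitive subtournaments (equivalently, at most $1.6740^n$ minimal feedback vertex sets).
   Context: A tournament $T=(V,A)$ is a directed graph with exactly one arc between every pair of distinct vertices. $T$ is strong if there is a directed path between any two vertices. A subtournament is a subgraph $T[V']$ induced by a vertex subset $V'\subseteq V$; it is transitive if it is acyclic, and a maximal transitive subtournament is a transitive subtournament $T[V']$ such that no $T[V'\cup\{v\}]$, $v\in V\setminus V'$, is transitive. A feedback vertex set is a set $F\subseteq V$ with $T[V\setminus F]$ acyclic; it is minimal if no proper subset is a feedback vertex set. The complements of minimal feedback vertex sets are exactly the vertex sets of maximal transitive subtournaments. *)

(* Defs.v *)
From HB Require Import structures.
From mathcomp Require Import all_boot all_order all_algebra.
From mathcomp Require Import boolp.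

Set Implicit Arguments.
Unset Strict Implicit.
Unset Printing Implicit Defensive.

Section Tournaments.

Variables (V : finType) (arc : rel V).
Implicit Types S F : {set V}.

Definition tournament :=
  irreflexive arc /\ forall x y, x != y -> arc x y (+) arc y x.

Definition strong := forall x y, connect arc x y.

(* The empty sequence counts as a cycle in path.v, and [:: x] is one iff there
   is a loop at x. *)
Definition acyclic (r : rel V) := forall c : seq V, ucycle r c -> c = [::].

(* The arcs of the subgraph induced by S. The relation stays on V; the vertices
   outside S become isolated, which does not affect acyclicity. *)
Definition induced S : rel V := [rel x y | [&& x \in S, y \in S & arc x y]].

Definition transitive_on S := acyclic (induced S).

Definition maximal_transitive S :=
  transitive_on S /\ forall v, v \notin S -> ~ transitive_on (v |: S).

Definition feedback_vertex_set F := acyclic (induced (~: F)).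

Definition minimal_feedback_vertex_set F :=
  feedback_vertex_set F /\
  forall F', F' \proper F -> ~ feedback_vertex_set F'.

Definition maximal_transitive_sets : {set {set V}} :=
  [set S : {set V} | `[< maximal_transitive S >]].

Definition minimal_feedback_vertex_sets : {set {set V}} :=
  [set F : {set V} | `[< minimal_feedback_vertex_set F >]].

End Tournaments.

(* Main.v *)
(* Strongness is not needed. Let M(X) be the number of maximal transitive sets
   of the subtournament on X, and b = 837/500; M(X) <= b^|X| follows by induction
   on |X|.

   If every in-degree is at least 2, group the sets by their source w: there are
   at most M(N+(w)) of them, and one vertex more can be dropped when N+(w) itself
   has a source. With e_w the in-degree of w, increased by 1 in the latter case,
   M(X) <= b^(|X|-1) * sum_w b^(-e_w). Each vertex v of in-degree 2 is the source
   of N+(w) for one of its two in-neighbours w, and distinct v have distinct w.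
   So e satisfies Landau's inequalities with a surplus of 1 for each vertex of
   in-degree 2, and convexity of x |-> b^(-x) bounds the sum by b.

   If v has a single in-neighbour u, split by S :&: N-(u) the sets S containing
   u, and use that v is a source of X \ {u} for the others. *)

Require Import Defs.
From mathcomp Require Import all_boot all_order all_algebra.
From mathcomp Require Import boolp.
From mathcomp Require Import zify ring lra.
Import Order.TTheory GRing.Theory Num.Theory.

Set Implicit Arguments.
Unset Strict Implicit.
Unset Printing Implicit Defensive.

(** * Acyclicity, transitivity and domination in a tournament *)

Section Combinatorics.
Variables (V : finType) (arc : rel V).
Hypothesis T : tournament arc.
Implicit Types (X Y S P W : {set V}) (u v w x y z : V).

Lemma arc_irr x : arc x x = false.
Proof. by have [irr _] := T; apply: irr. Qed.

Lemma arcC x y : x != y -> arc y x = ~~ arc x y.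
Proof. by have [_ tot] := T => /tot; case: (arc x y); case: (arc y x). Qed.

Lemma arc_neq x y : arc x y -> x != y.
Proof. by case: eqVneq => // ->; rewrite arc_irr. Qed.

Lemma arc_asym x y : arc x y -> arc y x = false.
Proof. by move=> xy; rewrite arcC ?xy // arc_neq. Qed.

Definition transb S :=
  [forall x in S, forall y in S, forall z in S, arc x y ==> arc y z ==> arc x z].

Lemma transbP S :
  reflect {in S & &, transitive arc} (transb S).
Proof.
apply: (iffP idP) => [/forall_inP tS y x z Sy Sx Sz xy yz | tS].
  by have /forall_inP/(_ _ Sy)/forall_inP/(_ _ Sz) := tS _ Sx; rewrite xy yz.
apply/forall_inP=> x Sx; apply/forall_inP=> y Sy; apply/forall_inP=> z Sz.
by apply/implyP=> xy; apply/implyP; apply: tS.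
Qed.

Lemma transbS S S' : S' \subset S -> transb S -> transb S'.
Proof.
move=> /subsetP sub /transbP tS; apply/transbP => y x z Sy Sx Sz.
by apply: tS; apply: sub.
Qed.

Definition dominates S S' := [forall x in S, forall y in S', arc x y].

Lemma dominatesP S S' :
  reflect {in S & S', forall x y, arc x y} (dominates S S').
Proof.
apply: (iffP forall_inP) => [dom x y /dom/forall_inP|dom x Sx]; first exact.
by apply/forall_inP => y; apply: dom.
Qed.

Lemma transbU S S' :
  transb S -> transb S' -> dominates S S' -> transb (S :|: S').
Proof.
move=> /transbP tS /transbP tS' /dominatesP dom; apply/transbP => y x z.
have ndom a b : a \in S -> b \in S' -> arc b a -> False.
  by move=> Sa Sb; rewrite (arc_asym (dom _ _ Sa Sb)).
rewrite !inE => /orP[] Hy /orP[] Hx /orP[] Hz xy yz.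
- exact: tS xy yz.
- exact: dom.
- by case: (ndom _ _ Hy Hx).
- by case: (ndom _ _ Hy Hx).
- by case: (ndom _ _ Hz Hy).
- exact: dom.
- by case: (ndom _ _ Hz Hy).
- exact: tS' xy yz.
Qed.

Lemma transb1 v : transb [set v].
Proof. by apply/transbP => y x z /set1P -> /set1P ->. Qed.

Lemma inducedE S x y : induced arc S x y = [&& x \in S, y \in S & arc x y].
Proof. by []. Qed.

(** A failure of transitivity closes up to a directed triangle. Conversely, transitivity along a
    cycle yields a loop at its first vertex. *)
Lemma acyclic_induced S : acyclic (induced arc S) <-> transb S.
Proof.
split=> [acS|/transbP tS].
  apply/transbP => y x z Sy Sx Sz xy yz; case: (eqVneq x z) => [xz|xz].
    by move: yz; rewrite -xz (arc_asym xy).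
  apply: contraT => nxz; have zx : arc z x by rewrite arcC.
  suff /acS : ucycle (induced arc S) [:: x; y; z] by [].
  by rewrite /ucycle /= !inducedE Sx Sy Sz xy yz zx !inE negb_or (arc_neq xy) xz arc_neq.
case=> [//|x c] /andP[/= cyc _].
have tr : transitive (induced arc S).
  move=> b a d /and3P[Sa Sb ab] /and3P[_ Sd bd].
  by apply/and3P; split => //; apply: tS ab bd.
have := order_path_min tr cyc; rewrite all_rcons /=.
by rewrite inducedE arc_irr !andbF.
Qed.

(** * Counting maximal transitive sets of a subtournament *)

Definition mts X : {set {set V}} :=
  [set S : {set V} | [&& S \subset X, transb S &
    [forall v in X :\: S, ~~ transb (v |: S)]]].

Definition in_nbrs X v := [set x in X | arc x v].
Definition out_nbrs X v := [set x in X | arc v x].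

Lemma mtsP X S : reflect [/\ S \subset X, transb S &
    forall v, v \in X -> transb (v |: S) -> v \in S] (S \in mts X).
Proof.
rewrite inE; apply: (iffP and3P) => -[sSX tS mS]; split=> //.
  move=> v Xv tv; apply: contraTT tv => nSv.
  by have /forall_inP := mS; apply; rewrite inE nSv.
apply/forall_inP => v; rewrite inE => /andP[nSv Xv].
by apply: contra nSv; apply: mS.
Qed.

(** This is the source of all the recurrences. The sets of [F] agree outside [Y], so [S :&: Y]
    determines [S]. It is maximal in [Y]: since [P] dominates [Y], a vertex of [Y] that extends
    [S :&: Y] also extends [S]. *)
Lemma card_mts_dominated (F : {set {set V}}) X Y P :
  F \subset mts X -> Y \subset X -> dominates P Y ->
  (forall S, S \in F -> S :\: Y = P) -> #|F| <= #|mts Y|.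
Proof.
move=> /subsetP sF sYX dom FP.
have FE S : S \in F -> S = P :|: (S :&: Y) by move/FP <-; rewrite setUC setID.
have inj : {in F &, injective (fun S => S :&: Y)}.
  by move=> S S' FS FS' /= E; rewrite (FE _ FS) (FE _ FS') E.
rewrite -(card_in_imset inj); apply: subset_leq_card.
apply/subsetP => _ /imsetP[S FS ->].
have /mtsP[sSX tS mS] := sF _ FS.
apply/mtsP; split; [exact: subsetIr|exact: transbS (subsetIl _ _) tS|].
move=> v Yv tv; rewrite inE Yv andbT; apply: mS; first exact: (subsetP sYX).
rewrite [S]FE // setUCA; apply: transbU => //.
  by apply: transbS tS; rewrite -(FP _ FS) subsetDl.
apply/dominatesP => x y Px; rewrite !inE => /predU1P[->|/andP[_ Yy]];
  exact: (dominatesP _ _ dom).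
Qed.

Lemma mts_dominating_vertex X S v :
  S \in mts X -> v \in X -> dominates [set v] (S :\ v) -> v \in S.
Proof.
move=> /mtsP[sSX tS mS] Xv dom; apply: contraT => nSv.
suff : v \in S by rewrite (negbTE nSv).
apply: mS => //; apply: transbU => //; first exact: transb1.
suff -> : S = S :\ v by [].
by apply/esym/setDidPl; rewrite disjoint_sym disjoints1.
Qed.

Lemma card_mts_source X v :
  v \in X -> dominates [set v] (X :\ v) -> #|mts X| <= #|mts (X :\ v)|.
Proof.
move=> Xv dom; apply: (@card_mts_dominated _ X _ [set v]) => //.
  exact: subsetDl.
move=> S FS; have /mtsP[sSX _ _] := FS.
have vS : v \in S.
  apply: (mts_dominating_vertex FS) => //.
  apply/dominatesP => x y x1; rewrite !inE => /andP[yv Sy].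
  by apply: (dominatesP _ _ dom) => //; rewrite !inE yv (subsetP sSX).
apply/setP => x; rewrite !inE; case: eqVneq => [->|_] //=.
by case: (boolP (x \in S)) => [/(subsetP sSX) ->|]; rewrite ?andbF.
Qed.

Lemma card_out_in X w : w \in X -> #|out_nbrs X w| + #|in_nbrs X w| + 1 = #|X|.
Proof.
move=> Xw; rewrite (cardsD1 w X) Xw addnC; congr (_ + _).
rewrite -cardsUI [X in _ + X](_ : _ = 0); last first.
  apply: eq_card0 => x; rewrite !inE; apply/negP.
  by case/andP=> /andP[_ wx] /andP[_]; rewrite (arc_asym wx).
rewrite addn0; apply: eq_card => x; rewrite !inE -andb_orr andbC.
case: eqVneq => [->|xw]; first by rewrite arc_irr.
by rewrite (arcC xw); case: (arc x w).
Qed.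

(** Take [w] of maximal out-degree in [S]. An in-neighbour [y] of [w] would, by transitivity, beat
    [w] and everything that [w] beats. *)
Lemma trans_source S : S != set0 -> transb S ->
  exists2 w, w \in S & dominates [set w] (S :\ w).
Proof.
case/set0Pn => x0 Sx0 /transbP tS.
case: (arg_maxnP (fun w => #|out_nbrs S w|) Sx0) => w Sw wmax.
exists w => //; apply/dominatesP => _ y /set1P -> ; rewrite !inE => /andP[yw Sy].
apply: contraT => nwy; have yw' : arc y w by rewrite arcC // eq_sym.
have : #|out_nbrs S y| <= #|out_nbrs S w| := wmax y Sy; rewrite leqNgt => /negP[].
apply: proper_card; apply/properP; split; last first.
  by exists w; rewrite inE ?yw' ?arc_irr ?andbF ?andbT.
apply/subsetP => z; rewrite !inE => /andP[Sz wz]; rewrite Sz /=.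
exact: tS yw' wz.
Qed.

Lemma card_mts_sources X : X != set0 ->
  #|mts X| <= \sum_(w in X) #|mts (out_nbrs X w)|.
Proof.
move=> X0.
pose F w := [set S in mts X | (w \in S) && dominates [set w] (S :\ w)].
have cov : mts X \subset \bigcup_(w in X) F w.
  apply/subsetP => S mS; have /mtsP[sSX tS maxS] := mS.
  have S0 : S != set0.
    apply: contraNneq X0 => S0; apply/eqP/setP => x; rewrite [RHS]inE.
    apply: contraTF isT => Xx; have := maxS x Xx.
    by rewrite S0 setU0 inE transb1 => /(_ isT).
  have [w Sw dom] := trans_source S0 tS.
  by apply/bigcupP; exists w; rewrite ?(subsetP sSX) // inE mS Sw.
apply: leq_trans (subset_leq_card cov) _.
apply: leq_trans (_ : \sum_(w in X) #|F w| <= _).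
  elim/big_rec2: _ => [|w Y m _ IH]; first by rewrite cards0.
  by rewrite cardsU (leq_trans (leq_subr _ _)) // leq_add2l.
apply: leq_sum => w Xw; apply: (@card_mts_dominated _ X _ [set w]).
- by apply/subsetP => S; rewrite inE => /andP[].
- by apply/subsetP => x; rewrite inE => /andP[].
- by apply/dominatesP => _ y /set1P ->; rewrite inE => /andP[].
move=> S; rewrite inE => /and3P[/mtsP[sSX _ _] Sw /dominatesP dom].
apply/setP => x; rewrite !inE; case: eqVneq => [->|xw].
  by rewrite Sw arc_irr andbF.
case: (boolP (x \in S)) => [Sx|]; rewrite ?andbF // (subsetP sSX) //=.
by rewrite dom ?inE ?xw.
Qed.

Lemma card_mts_del X v :
  #|[set S in mts X | v \notin S]| <= #|mts (X :\ v)|.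
Proof.
apply: (@card_mts_dominated _ X _ set0).
- by apply/subsetP => S; rewrite inE => /andP[].
- exact: subsetDl.
- by apply/dominatesP => x y; rewrite inE.
move=> S; rewrite inE => /andP[/mtsP[sSX _ _] nvS].
apply/setP => x; rewrite !inE; case: eqVneq => [->|_]; first by rewrite (negbTE nvS).
by case: (boolP (x \in S)) => [/(subsetP sSX) ->|]; rewrite ?andbF.
Qed.

(** * Vertices with a single in-neighbour *)

Lemma arc_unique_in_nbr X u v x :
  v \in X -> in_nbrs X v = [set u] -> x \in X -> x != u -> x != v -> arc v x.
Proof.
move=> Xv inv Xx xu xv; apply: contraT => nvx.
have : x \in in_nbrs X v by rewrite inE Xx arcC // eq_sym.
by rewrite inv inE (negbTE xu).
Qed.

(** Without [u], the vertex [v] dominates the rest of [S] and hence lies in [S] by maximality. *)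
Lemma card_mts_avoid_in_nbr X u v : v \in X -> in_nbrs X v = [set u] ->
  #|[set S in mts X | u \notin S]| <= #|mts (X :\ u :\ v)|.
Proof.
move=> Xv inv; apply: (@card_mts_dominated _ X _ [set v]).
- by apply/subsetP => S; rewrite inE => /andP[].
- by apply/subsetP => x; rewrite !inE => /and3P[].
- apply/dominatesP => _ y /set1P ->; rewrite !inE => /and3P[yv yu Xy].
  by apply: (arc_unique_in_nbr Xv inv).
move=> S; rewrite inE => /andP[mS nuS]; have /mtsP[sSX _ _] := mS.
have vS : v \in S.
  apply: (mts_dominating_vertex mS Xv).
  apply/dominatesP => _ y /set1P ->; rewrite !inE => /andP[yv Sy].
  apply: (arc_unique_in_nbr Xv inv) => //; first exact: (subsetP sSX).
  by apply: contraNneq nuS => <-.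
apply/setP => x; rewrite !inE; case: eqVneq => [->|_] //=.
case: eqVneq => [->|_] /=; first by rewrite (negbTE nuS).
by case: (boolP (x \in S)) => [/(subsetP sSX) ->|]; rewrite ?andbF.
Qed.

(** An in-neighbour of [u] in [S] together with [v] would, by transitivity through [u], be a second
    in-neighbour of [v]. If there is none, [u] is the source of [S] and [v] fits directly after
    it. *)
Lemma mts_unique_in_nbr X u v S :
  v \in X -> in_nbrs X v = [set u] -> S \in mts X -> u \in S ->
  (v \in S) = (S :&: in_nbrs X u == set0).
Proof.
move=> Xv inv mS Su; have /mtsP[sSX /transbP tS maxS] := mS.
have /setIdP[Xu uv] : u \in in_nbrs X v by rewrite inv inE.
apply/idP/eqP => [Sv|W0].
  apply/setP => w; rewrite !inE; apply/negbTE/negP => /and3P[Sw Xw wu].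
  have wv := tS _ _ _ Su Sw Sv wu uv.
  have : w \in in_nbrs X v by rewrite inE Xw.
  by rewrite inv inE => /eqP wE; rewrite wE arc_irr in wu.
apply: contraT => nSv; suff : v \in S by rewrite (negbTE nSv).
apply: maxS => //.
have -> : v |: S = [set u] :|: ([set v] :|: (S :\ u)).
  by rewrite setUCA; congr (_ :|: _); rewrite setD1K.
have Sneq x : x \in S -> x != v by move=> Sx; apply: contraNneq nSv => <-.
apply: transbU; first exact: transb1.
  apply: transbU; [exact: transb1|exact/(transbS (subsetDl _ _))/transbP|].
  apply/dominatesP => _ y /set1P ->; rewrite !inE => /andP[yu Sy].
  by apply: (arc_unique_in_nbr Xv inv); rewrite ?(subsetP sSX) ?Sneq.
apply/dominatesP => _ y /set1P ->; rewrite !inE => /predU1P[->//|/andP[yu Sy]].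
apply: contraT => nuy; have : y \in S :&: in_nbrs X u.
  by rewrite !inE Sy (subsetP sSX) // arcC // eq_sym.
by rewrite W0 inE.
Qed.

Lemma card_mts_prefix X u v W :
  v \in X -> in_nbrs X v = [set u] -> W \subset in_nbrs X u ->
  exists2 Y : {set V}, #|Y| + #|in_nbrs X u| + 2 <= #|X| &
    #|[set S in mts X | (u \in S) && (S :&: in_nbrs X u == W)]| <= #|mts Y|.
Proof.
move=> Xv inv sW.
have /setIdP[Xu uv] : u \in in_nbrs X v by rewrite inv inE.
(* Whatever comes after [u] in [S], apart from [v], is beaten by [u] and, by transitivity through
   [u], by all of [W]. *)
exists [set x in out_nbrs X u :\ v | dominates W [set x]].
  apply: (@leq_trans (#|out_nbrs X u :\ v| + #|in_nbrs X u| + 2)).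
    by rewrite !leq_add2r subset_leq_card //; apply/subsetP => x; rewrite inE => /andP[].
  rewrite -(card_out_in Xu) (cardsD1 v (out_nbrs X u)) inE Xv uv; lia.
(* The part of [S] outside this set: by [mts_unique_in_nbr], [v] belongs to [S] exactly when [W] is
   empty. *)
pose P := u |: (if W == set0 then [set v] else W).
apply: (@card_mts_dominated _ X _ P).
- by apply/subsetP => S; rewrite inE => /andP[].
- by apply/subsetP => x; rewrite !inE => /andP[/and3P[]].
- apply/dominatesP => x y Px; rewrite !inE => /andP[/and3P[yv Xy uy]].
  move=> /dominatesP/(_ _ _ _ (set11 y)) domW.
  move: Px; rewrite !inE => /predU1P[->//|]; case: ifP => _; last exact: domW.
  move=> /set1P ->; apply: (arc_unique_in_nbr Xv inv) => //.
  by rewrite eq_sym arc_neq.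
move=> S; rewrite inE => /and3P[mS Su /eqP SW].
have /mtsP[sSX /transbP tS maxS] := mS.
have vS := mts_unique_in_nbr Xv inv mS Su.
apply/setP => x; rewrite !inE.
case: (eqVneq x u) => [->|xu]; first by rewrite arc_irr !andbF Su.
case: (eqVneq x v) => [->|xv] /=.
  rewrite vS SW; case: eqVneq => [_|_]; first by rewrite set11.
  apply/esym/negbTE; apply: contraL uv => /(subsetP sW).
  by rewrite inE Xv => /= vu; rewrite arc_asym.
have -> : (x \in (if W == set0 then [set v] else W)) = (x \in W).
  by case: eqVneq => // ->; rewrite !inE (negbTE xv).
rewrite -SW !inE; case: (boolP (x \in S)) => [Sx|]; rewrite ?andbF //.
rewrite (subsetP sSX) //= andbT (arcC xu).
case: (boolP (arc x u)) => //= nxu; apply/negbTE/negPn.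
have ux : arc u x by rewrite arcC.
apply/dominatesP => w _ Ww /set1P ->; move: Ww; rewrite !inE.
by case/and3P => Sw _ wu; apply: tS wu ux.
Qed.

(** * Landau's inequalities for reduced in-degrees *)

Lemma sum_card_in_nbrs S :
  2 * \sum_(w in S) #|in_nbrs S w| = #|S| * (#|S| - 1).
Proof.
have inE' w : #|in_nbrs S w| = \sum_(x in S) arc x w.
  by rewrite -sum1_card big_mkcond [RHS]big_mkcond; apply: eq_bigr => x _;
     rewrite inE; case: (x \in S); case: (arc x w).
have outE w : #|out_nbrs S w| = \sum_(x in S) arc w x.
  by rewrite -sum1_card big_mkcond [RHS]big_mkcond; apply: eq_bigr => x _;
     rewrite inE; case: (x \in S); case: (arc w x).
have sumE : \sum_(w in S) #|out_nbrs S w| = \sum_(w in S) #|in_nbrs S w|.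
  under eq_bigr do rewrite outE.
  by rewrite exchange_big /=; apply: eq_bigr => w _; rewrite inE'.
have : \sum_(w in S) (#|out_nbrs S w| + #|in_nbrs S w| + 1) = #|S| * #|S|.
  by rewrite -sum_nat_const; apply: eq_bigr => w; apply: card_out_in.
rewrite !big_split /= sumE sum1_card; nia.
Qed.

Definition out_source X w v :=
  (v \in out_nbrs X w) && dominates [set v] (out_nbrs X w :\ v).

(* When [out_source X w v], every maximal transitive set with source w contains
   v, so w counts as if it had one more in-neighbour. *)
Definition reduced_indeg X w := #|in_nbrs X w| + [exists v, out_source X w v].

Lemma out_source_inj X w v v' :
  out_source X w v -> out_source X w v' -> v = v'.
Proof.
move=> /andP[wv /dominatesP dv] /andP[wv' /dominatesP dv']; apply/eqP.
apply: contraT => vv'.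
have a1 : arc v v' by apply: dv; rewrite ?set11 // in_setD1 eq_sym vv'.
have a2 : arc v' v by apply: dv'; rewrite ?set11 // in_setD1 vv'.
by rewrite (arc_asym a1) in a2.
Qed.

(** If the in-neighbours are a and b with an arc from a to b, take w = b: neither a nor b is an
    out-neighbour of b, so [v] has no in-neighbour left there. *)
Lemma out_source_indeg2 X v : v \in X -> #|in_nbrs X v| = 2 ->
  exists2 w, w \in in_nbrs X v & out_source X w v.
Proof.
move=> Xv /eqP/cards2P[a [b [ab inv]]].
wlog arcab : a b ab inv / arc a b.
  move=> wl; case: (boolP (arc a b)) => [|nab]; first exact: wl inv.
  by apply: (wl b a); [rewrite eq_sym | rewrite inv setUC | rewrite arcC].
have inb : b \in in_nbrs X v by rewrite inv !inE eqxx orbT.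
exists b => //; move: (inb); rewrite inE => /andP[Xb bv].
rewrite /out_source inE Xv bv; apply/dominatesP => _ x /set1P ->.
rewrite !inE => /and3P[xv Xx bx]; apply: contraT => nvx.
have : x \in in_nbrs X v by rewrite inE Xx arcC // eq_sym.
rewrite inv !inE => /orP[] /eqP xE; move: bx; rewrite xE ?arc_irr //.
by rewrite (arc_asym arcab).
Qed.

(** In-degrees inside [S] already give the first term. A vertex of in-degree 2 contributes one more:
    either it has an in-neighbour outside [S] ([K2]), or both in-neighbours are in [S] ([K1]) and
    one of them gets its reduced in-degree increased on its account. *)
Lemma reduced_indeg_landau X S : S \subset X ->
  #|S| * (#|S| - 1) + 2 * #|[set v in S | #|in_nbrs X v| == 2]|
    <= 2 * \sum_(w in S) reduced_indeg X w.
Proof.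
move=> sSX; rewrite -sum_card_in_nbrs -mulnDr leq_mul2l /=.
have inD w : #|in_nbrs X w| = #|in_nbrs S w| + #|in_nbrs X w :\: S|.
  rewrite -(cardsID S (in_nbrs X w)); congr (#|pred_of_set _| + _).
  apply/setP => x; rewrite !inE.
  by case: (boolP (x \in S)) => [/(subsetP sSX) ->|]; rewrite ?andbT ?andbF.
rewrite big_split /= (eq_bigr _ (fun w _ => inD w)) big_split /= -addnA leq_add2l.
pose K1 := [set v in S | (#|in_nbrs X v| == 2) && (in_nbrs X v \subset S)].
pose K2 := [set v in S | 0 < #|in_nbrs X v :\: S|].
apply: (@leq_trans (#|K2| + #|K1|)).
  have [le12 _] := leq_card_setU K2 K1; apply: leq_trans le12; apply: subset_leq_card.
  apply/subsetP => v; rewrite !inE => /andP[-> ->] /=.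
  by rewrite -setD_eq0 -cards_eq0 lt0n; case: eqP.
apply: leq_add.
  rewrite -sum1_card [leqLHS]big_mkcond [leqRHS]big_mkcond /=.
  by apply: leq_sum => v _; rewrite inE; case: (v \in S) => //=; case: ltnP.
rewrite -sum1_card [leqRHS](_ : _ =
    #|[set w in S | [exists v, out_source X w v]]|); last first.
  rewrite -sum1_card big_mkcond [RHS]big_mkcond; apply: eq_bigr => w _.
  by rewrite inE; case: (w \in S) => //=; case: [exists v, _].
rewrite sum1_card.
(* [g] maps [w] to the source of its out-neighbourhood. The default is never taken on the set whose
   image is used, and this image covers [K1]. *)
pose g w := odflt w [pick v | out_source X w v].
apply: leq_trans (leq_imset_card g _); apply: subset_leq_card.
apply/subsetP => v; rewrite inE => /and3P[Sv /eqP inv /subsetP sub].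
have [w inw srcw] := out_source_indeg2 (subsetP sSX _ Sv) inv.
apply/imsetP; exists w; first by rewrite inE sub //; apply/existsP; exists v.
rewrite /g; case: pickP => [v' /= srcw'|/(_ v)]; last by rewrite srcw.
exact: out_source_inj srcw srcw'.
Qed.

Lemma card_mts_out_nbrs X w : w \in X ->
  exists2 Y : {set V}, #|Y| + reduced_indeg X w + 1 = #|X| &
    #|mts (out_nbrs X w)| <= #|mts Y|.
Proof.
move=> Xw; rewrite /reduced_indeg; case: existsP => [[v /andP[wv dom]]|_].
  exists (out_nbrs X w :\ v); last exact: card_mts_source.
  by rewrite -(card_out_in Xw) (cardsD1 v (out_nbrs X w)) wv; lia.
by exists (out_nbrs X w); rewrite // -(card_out_in Xw); lia.
Qed.

End Combinatorics.

(** * Convex sums under Landau's inequalities *)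

Section Majorization.
Variables (V : finType) (X : {set V}) (h : V -> nat).
Hypothesis landau : forall S : {set V}, S \subset X ->
  #|S| * (#|S| - 1) <= 2 * \sum_(v in S) h v.

(** Truncated subtraction serves as the hinge function, so only the set S where [h] is at most [t]
    counts. With s = |S|, Landau bounds the left side by s(2t + 1 - s), and (t - s)(t + 1 - s) >= 0
    for integers. *)
Lemma sum_hinge t : 2 * \sum_(v in X) (t - h v) <= t * (t + 1).
Proof.
pose S := [set v in X | h v <= t].
have -> : \sum_(v in X) (t - h v) = \sum_(v in S) (t - h v).
  rewrite big_mkcond [RHS]big_mkcond; apply: eq_bigr => v _.
  rewrite inE; case: (v \in X) => //=; case: leqP => // /ltnW.
  by rewrite -subn_eq0 => /eqP.
have sSX : S \subset X by apply/subsetP => v; rewrite inE => /andP[].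
have := landau sSX.
have : \sum_(v in S) (t - h v) + \sum_(v in S) h v = #|S| * t.
  rewrite -big_split /= -sum_nat_const; apply: eq_bigr => v.
  by rewrite inE => /andP[_]; apply: subnK.
move: (\sum_(v in S) (t - h v)) (\sum_(v in S) h v) => a b.
case: (leqP #|S| t) => [/subnKC <-|/subnKC <-]; nia.
Qed.

Local Open Scope ring_scope.

Variables (R : realFieldType) (q : R).
Hypothesis q01 : 0 < q < 1.

(* [q ^ d] for [t <= d], extended to [d < t] by the line through its values at t
   and t + 1. *)
Definition exp_tangent (t d : nat) : R :=
  q ^+ maxn t d + (t - d)%N%:R * (1 - q) * q ^+ t.

(* The sum of [exp_tangent t d] over all natural numbers d, the scores of an
   infinite transitive tournament. *)
Definition exp_tangent_bound (t : nat) : R :=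
  q ^+ t * (t%:R + (1 - q) * (t%:R * (t%:R + 1)) / 2 + (1 - q)^-1).

(** Moving the tangent from t to t + 1 changes nothing for d > t and changes the slope below by (1 -
    q)^2 q^t. The difference is thus a nonnegative multiple of a hinge function. *)
Lemma exp_tangentS t d :
  exp_tangent t d = exp_tangent t.+1 d + (t.+1 - d)%N%:R * ((1 - q) ^+ 2 * q ^+ t).
Proof.
rewrite /exp_tangent; case: (ltnP t d) => td.
  rewrite (maxn_idPr td).
  have /eqP -> : (t - d == 0)%N by rewrite subn_eq0 ltnW.
  have /eqP -> : (t.+1 - d == 0)%N by rewrite subn_eq0.
  by rewrite !mul0r !addr0.
rewrite (maxn_idPl (leqW td)) subSn // exprS -natr1.
ring.
Qed.

Lemma exp_tangent_boundS t :
  exp_tangent_bound t = exp_tangent_bound t.+1 +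
    (t.+1%:R * (t.+1%:R + 1)) / 2 * ((1 - q) ^+ 2 * q ^+ t).
Proof.
have q1 : 1 - q != 0 by rewrite subr_eq0; case/andP: q01 => _ /gt_eqF ->.
rewrite /exp_tangent_bound exprS -natr1; field.
by rewrite q1.
Qed.

Lemma sum_hinge_ring t :
  \sum_(v in X) (t - h v)%N%:R <= (t%:R * (t%:R + 1)) / 2 :> R.
Proof.
have := sum_hinge t; rewrite addn1 -(ler_nat R) !natrM natr_sum => le_h.
by rewrite ler_pdivlMr ?ltr0n // natr1 mulrC.
Qed.

(** While [t] is less than the size of [X], pass to t + 1 and bound the hinge term by
    [sum_hinge_ring]; the bounds telescope in the same way. Once [t] has reached the size of [X],
    estimating each power by [q ^+ t] suffices. *)
Lemma sum_exp_tangent t : \sum_(v in X) exp_tangent t (h v) <= exp_tangent_bound t.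
Proof.
have [q0 q1] := andP q01.
have qt n : 0 <= q ^+ n by rewrite exprn_ge0 // ltW.
have q1' : 0 <= 1 - q by rewrite subr_ge0 ltW.
have [k] := ubnP (#|X| - t)%N; elim: k t => // k IH t ltk.
case: (leqP #|X| t) => Xt; last first.
  rewrite (eq_bigr _ (fun v _ => exp_tangentS t (h v))) big_split /=.
  rewrite exp_tangent_boundS -mulr_suml lerD //.
    by apply: IH; move: ltk Xt; lia.
  by rewrite ler_wpM2r ?sum_hinge_ring // mulr_ge0 ?sqr_ge0.
have le1 v : v \in X -> exp_tangent t (h v) <=
    q ^+ t + (t - h v)%N%:R * ((1 - q) * q ^+ t).
  move=> _; rewrite /exp_tangent mulrA lerD2r.
  by rewrite ler_wiXn2l ?leq_maxl ?ltW.
apply: le_trans (ler_sum _ le1) _; rewrite big_split /= sumr_const -mulr_suml.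
have := sum_hinge_ring t; set A := \sum_(v in X) _ => leA.
have leX : #|X|%:R <= t%:R :> R by rewrite ler_nat.
have inv0 : 0 <= (1 - q)^-1 by rewrite invr_ge0.
rewrite /exp_tangent_bound -mulr_natl !mulrDr.
have p0 : 0 <= (1 - q) * q ^+ t by rewrite mulr_ge0.
have := ler_wpM2r p0 leA; have := ler_wpM2r (qt t) leX.
have := mulr_ge0 (qt t) inv0; nra.
Qed.

End Majorization.

(** Here k and m count the vertices with [h] equal to 1 and 3. The hypotheses are Landau's
    inequalities for the set of all these vertices and for those of value 1 alone. *)
Lemma landau_small_counts k m :
  (k + m) * (k + m - 1) <= 2 * (k + 3 * m) -> k * (k - 1) <= 2 * k ->
  2 * k + m <= 7 /\ k <= 3.
Proof.
move=> km kk; have k3 : k <= 3 by nia.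
have m7 : m <= 7 by nia.
move: km {kk}; case: k k3 => [|[|[|[|]]]] // _;
  by case: m m7 => [|[|[|[|[|[|[|[|]]]]]]]].
Qed.

(** * The numerical bound on the sum of weights *)

Section Numerics.
Local Open Scope ring_scope.
Variables (R : realFieldType) (b : R).
Hypothesis bE : b = 837 / 500.

(* [h v = 1] encodes reduced in-degree 2, absorbing the surplus in Landau's
   inequalities. The weights q^2, q^3, q^4 at h = 1, 3, 4 are not in convex
   position: convexity is used with the tangent at 4, and the excess at 1 and 3
   is bounded through [landau_small_counts]. *)
Lemma sum_weights (V : finType) (X : {set V}) (h : V -> nat) :
  (forall S : {set V}, S \subset X ->
    (#|S| * (#|S| - 1) <= 2 * \sum_(v in S) h v)%N) ->
  (forall v, v \in X -> h v = 1%N \/ (3 <= h v)%N) ->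
  \sum_(v in X) b^-1 ^+ (h v + (h v == 1%N)) <= b.
Proof.
move=> landau hX.
have : b^-1 = 500 / 837 by rewrite bE invf_div.
move: b^-1 => q qE.
have q01 : 0 < q < 1 by rewrite qE; lra.
(* These are the excesses of the weights over the tangent at [h] = 1 and 3; from 4 on, weight and
   tangent agree. *)
pose a1 := q ^+ 2 - exp_tangent q 4 1; pose a3 := q ^+ 3 - exp_tangent q 4 3.
pose A i := [set v in X | h v == i].
have AE i : (#|A i|)%:R = \sum_(v in X) (h v == i)%:R :> R.
  suff -> : #|A i| = (\sum_(v in X) (h v == i))%N by rewrite natr_sum.
  rewrite /A -sum1_card big_mkcond [RHS]big_mkcond; apply: eq_bigr => v _.
  by rewrite inE; case: (v \in X); case: (h v == i).
have -> : \sum_(v in X) q ^+ (h v + (h v == 1%N)) =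
    \sum_(v in X) exp_tangent q 4 (h v) + a1 * #|A 1%N|%:R + a3 * #|A 3|%:R.
  rewrite (AE 1%N) (AE 3) !mulr_sumr -!big_split /=; apply: eq_bigr => v /hX.
  case: (h v) => [|[|[|[|d]]]] [] //= _; rewrite ?mulr1 ?mulr0 ?addr0.
  - by rewrite /a1 addrC subrK.
  - by rewrite /a3 addrC subrK.
  - by rewrite /exp_tangent addn0 (maxn_idPr _) // !mul0r addr0.
have le4 := sum_exp_tangent landau q01 4.
have sA i : A i \subset X by apply/subsetP => v; rewrite inE => /andP[].
have sumA i : (\sum_(v in A i) h v = i * #|A i|)%N.
  by rewrite mulnC -sum_nat_const; apply: eq_bigr => v; rewrite inE => /andP[_ /eqP].
have dis : [disjoint A 1%N & A 3].
  by apply/pred0P => v /=; rewrite !inE; case: eqP => [->|]; rewrite ?andbF.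
have L13 : ((#|A 1%N| + #|A 3|) * (#|A 1%N| + #|A 3| - 1) <= 2 * (#|A 1%N| + 3 * #|A 3|))%N.
  have -> : (#|A 1%N| + #|A 3| = #|A 1%N :|: A 3|)%N.
    by rewrite -cardsUI (disjoint_setI0 dis) cards0 addn0.
  have := landau (A 1%N :|: A 3); rewrite subUset !sA => /(_ isT).
  rewrite (eq_bigl [in [predU A 1%N & A 3]]); last by move=> v; rewrite !inE.
  by rewrite bigU // !sumA mul1n.
have L1 : (#|A 1%N| * (#|A 1%N| - 1) <= 2 * #|A 1%N|)%N.
  by have := landau _ (sA 1); rewrite sumA mul1n.
(* This and the next two constants are decimal values rounded up. For k <= 3 and 2k + m <= 7, the
   excess 0.0757 k + 0.0346 m is largest at k = 3, m = 1, where it is 0.2617; added to 1.339 it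
   stays below 1.674. *)
have U4 : exp_tangent_bound q 4 <= 1339 / 1000.
  have -> : exp_tangent_bound q 4 = q ^+ 4 * (4 + (1 - q) * 10 + (1 - q)^-1).
    by rewrite /exp_tangent_bound; lra.
  have -> : 1 - q = 337 / 837 by rewrite qE; lra.
  by rewrite qE invf_div; lra.
have a1le : a1 <= 757 / 10000.
  have tE : exp_tangent q 4 1 = q ^+ 4 + 3 * (1 - q) * q ^+ 4 by [].
  by rewrite /a1 tE qE; lra.
have a3le : a3 <= 346 / 10000.
  have tE : exp_tangent q 4 3 = q ^+ 4 + 1 * (1 - q) * q ^+ 4 by [].
  by rewrite /a3 tE qE; lra.
have [] := landau_small_counts L13 L1.
rewrite -!(ler_nat R) natrD natrM.
have k0 : 0 <= #|A 1%N|%:R :> R by [].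
have m0 : 0 <= #|A 3|%:R :> R by [].
move: (ler_wpM2r k0 a1le) (ler_wpM2r m0 a3le) (le_trans le4 U4).
rewrite bE; clearbody a1 a3.
move: (\sum_(v in X) _) (#|A 1%N|%:R) (#|A 3|%:R) => s k m.
by clear; lra.
Qed.

End Numerics.

(** * Growth inequalities for [b] *)

Section Bound.
Local Open Scope ring_scope.
Variables (R : realFieldType) (b : R).
Hypothesis bE : b = 837 / 500.
Variables (V : finType) (arc : rel V).
Hypothesis T : tournament arc.
Implicit Types (X Y S W : {set V}) (u v w x : V).

Local Notation mts := (mts arc).
Local Notation in_nbrs := (in_nbrs arc).

Lemma b_gt1 : 1 < b. Proof. by rewrite bE; lra. Qed.
Lemma b_gt0 : 0 < b. Proof. exact: lt_trans ltr01 b_gt1. Qed.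

(** For the split over all subsets of the in-neighbourhood of u, of size j. The limit 3 is sharp:
    b^4 + 16 exceeds b^6. *)
Lemma in_nbr1_few_ineq k j : (j <= 3)%N ->
  b ^+ (j + k) + (2 ^ j)%:R * b ^+ k <= b ^+ (j + k + 2).
Proof.
move=> j3; have bk : 0 <= b ^+ k by rewrite exprn_ge0 // ltW // b_gt0.
have -> : b ^+ (j + k) + (2 ^ j)%:R * b ^+ k = b ^+ k * (b ^+ j + (2 ^ j)%:R).
  by rewrite exprD; ring.
have -> : b ^+ (j + k + 2) = b ^+ k * b ^+ (j + 2) by rewrite !exprD; ring.
rewrite ler_wpM2l //.
by case: j j3 => [|[|[|[|]]]] // _; rewrite bE; lra.
Qed.

(** This is where [b] is nearly tight: for j = 4 it says 1 <= b^4 (b^2 - b - 1), whose right side is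
    about 1.007 and would be below 1 for 1.673. *)
Lemma in_nbr1_many_ineq k j : (4 <= j)%N ->
  b ^+ (j + k) + b ^+ k + b ^+ (j + k + 1) <= b ^+ (j + k + 2).
Proof.
move=> /subnKC <-; set i := (j - 4)%N.
have bk : 0 <= b ^+ k by rewrite exprn_ge0 // ltW // b_gt0.
have bi : 1 <= b ^+ i by rewrite exprn_ege1 // ltW // b_gt1.
have -> : b ^+ (4 + i + k) + b ^+ k + b ^+ (4 + i + k + 1) =
  b ^+ k * (1 + b ^+ i * (b ^+ 4 + b ^+ 5)) by rewrite !exprD; ring.
have -> : b ^+ (4 + i + k + 2) = b ^+ k * (b ^+ i * b ^+ 6) by rewrite !exprD; ring.
rewrite ler_wpM2l // -lerBrDr -mulrBr.
apply: (le_trans bi); rewrite ler_peMr ?(le_trans ler01 bi) //.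
by rewrite bE; lra.
Qed.

Lemma ler_bexp m n : (m <= n)%N -> b ^+ m <= b ^+ n.
Proof. by apply: ler_weXn2l; apply: ltW b_gt1. Qed.

Lemma b_expK m n : b ^+ (m + n + 1) * b^-1 * b^-1 ^+ n = b ^+ m.
Proof.
have b0 : b != 0 by rewrite gt_eqF // b_gt0.
rewrite !exprD expr1 exprVn; field.
by rewrite b0 expf_neq0.
Qed.

Lemma card_split (I : finType) (A : {set I}) (p : pred I) :
  #|A| = (#|[set x in A | p x]| + #|[set x in A | ~~ p x]|)%N.
Proof.
rewrite -(cardsID [set x | p x] A); congr (_ + _)%N; apply: eq_card => x.
  by rewrite !inE.
by rewrite !inE andbC.
Qed.

(** * The induction on the size of the subtournament *)

Section Step.
Variable X : {set V}.
Hypothesis IH : forall Y, (#|Y| < #|X|)%N -> #|mts Y|%:R <= b ^+ #|Y|.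

Lemma IHle Y n : (#|Y| < #|X|)%N -> (#|Y| <= n)%N -> #|mts Y|%:R <= b ^+ n.
Proof. by move=> YX Yn; apply: le_trans (IH YX) (ler_bexp Yn). Qed.

Lemma bound_unique_in_nbr u v : v \in X -> in_nbrs X v = [set u] ->
  #|mts X|%:R <= b ^+ #|X|.
Proof.
move=> Xv inv; have /setIdP[Xu uv] : u \in in_nbrs X v by rewrite inv inE.
set N := in_nbrs X u; set j := #|N|.
pose F W := [set S in mts X | (u \in S) && (S :&: N == W)].
(* k is the number of out-neighbours of [u] other than [v]. *)
have [k nE] : exists k, #|X| = (j + k + 2)%N.
  have [Y leY _] := card_mts_prefix T Xv inv (sub0set N).
  by exists (#|X| - j - 2)%N; move: leY; rewrite -/N -/j; lia.
have FW W : W \subset N -> #|F W|%:R <= b ^+ k.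
  move=> /(card_mts_prefix T Xv inv)[Y leY leF].
  apply: le_trans (_ : #|mts Y|%:R <= _); first by rewrite ler_nat.
  by apply: IHle; move: leY; rewrite -/N -/j nE; lia.
have X1 : #|X :\ v| = (j + k + 1)%N.
  by move: nE; rewrite (cardsD1 v X) Xv; lia.
have X2 : #|X :\ u :\ v| = (j + k)%N.
  move: nE; rewrite (cardsD1 u X) Xu (cardsD1 v (X :\ u)).
  rewrite !inE Xv (eq_sym v) (arc_neq T uv) /=; lia.
have avoid : #|[set S in mts X | u \notin S]|%:R <= b ^+ (j + k).
  apply: le_trans (_ : #|mts (X :\ u :\ v)|%:R <= _).
    by rewrite ler_nat; apply: card_mts_avoid_in_nbr.
  by apply: IHle; rewrite X2 // nE; lia.
rewrite (card_split _ (fun S => u \in S)) natrD addrC nE.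
case: (leqP j 3) => j3.
  apply: le_trans (in_nbr1_few_ineq k j3); apply: lerD avoid _.
  have -> : #|[set S in mts X | u \in S]| = (\sum_(W in powerset N) #|F W|)%N.
    rewrite -sum1_card (partition_big (fun S => S :&: N) (mem (powerset N))) /=.
      apply: eq_bigr => W _; rewrite -sum1_card; apply: eq_bigl => S.
      by rewrite !inE -andbA.
    by move=> S _; rewrite powersetE subsetIr.
  rewrite natr_sum -card_powerset mulr_natl -sumr_const; apply: ler_sum => W.
  by rewrite powersetE; apply: FW.
(* With many in-neighbours of [u], only distinguish whether [S] meets [N]. If it does, [v] is not in
   [S] and can be deleted from [X]. *)
apply: le_trans (in_nbr1_many_ineq k j3).
rewrite -addrA; apply: lerD avoid _.
rewrite (card_split _ (fun S => S :&: N == set0)) natrD; apply: lerD.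
  apply: le_trans (FW _ (sub0set N)); rewrite ler_nat; apply: subset_leq_card.
  by apply/subsetP => S; rewrite !inE -andbA.
apply: le_trans (_ : #|mts (X :\ v)|%:R <= _); last first.
  by apply: IHle; rewrite X1 // nE; lia.
rewrite ler_nat; apply: leq_trans (card_mts_del T X v); apply: subset_leq_card.
apply/subsetP => S; rewrite inE => /andP[/setIdP[mS Su] SN0].
by rewrite inE mS (mts_unique_in_nbr T Xv inv mS Su).
Qed.

Lemma bound_indeg_ge2 : X != set0 ->
  (forall v, v \in X -> (2 <= #|in_nbrs X v|)%N) ->
  #|mts X|%:R <= b ^+ #|X|.
Proof.
move=> X0 deg2; pose e := reduced_indeg arc X.
(* Reduced in-degree 2 forces in-degree exactly 2, so lowering these values to 1 uses up at most the
   surplus in [reduced_indeg_landau]. *)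
pose h v := if e v == 2 then 1%N else e v.
have e2 v : v \in X -> (2 <= e v)%N.
  by move=> /deg2/leq_trans; apply; apply: leq_addr.
have eE v : v \in X -> e v = (h v + (h v == 1))%N.
  by move=> /e2; rewrite /h; case: (e v) => [|[|[|d]]] // _; rewrite addn0.
have hX v : v \in X -> h v = 1%N \/ (3 <= h v)%N.
  by move=> /e2; rewrite /h; case: (e v) => [|[|[|]]] //=; [left | right].
have landau S : S \subset X ->
    (#|S| * (#|S| - 1) <= 2 * \sum_(v in S) h v)%N.
  move=> sSX; rewrite -(leq_add2r (2 * #|[set v in S | #|in_nbrs X v| == 2]|)).
  apply: leq_trans (reduced_indeg_landau T sSX) _.
  rewrite -mulnDr leq_mul2l /= -sum1_card [X in (_ <= _ + X)%N]big_mkcond /=.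
  rewrite [X in (_ <= X + _)%N]big_mkcond [leqLHS]big_mkcond -big_split /=.
  apply: leq_sum => v _; rewrite inE; case: (boolP (v \in S)) => //= Sv.
  have Xv := subsetP sSX _ Sv; have := deg2 v Xv; rewrite -/(e v) /h.
  case: eqVneq => [ev|_ _]; last exact: leq_addr.
  have : (#|in_nbrs X v| <= e v)%N by apply: leq_addr.
  by rewrite ev => le2 ge2; rewrite eqn_leq le2 ge2.
have outb v : v \in X ->
    #|mts (out_nbrs arc X v)|%:R <= b ^+ #|X| * b^-1 * b^-1 ^+ (h v + (h v == 1%N)).
  move=> Xv; have [Y cY leY] := card_mts_out_nbrs T Xv.
  apply: le_trans (_ : #|mts Y|%:R <= _); first by rewrite ler_nat.
  have -> : b ^+ #|X| * b^-1 * b^-1 ^+ (h v + (h v == 1%N)) = b ^+ #|Y|.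
    by rewrite -eE // -cY b_expK.
  by apply: IH; rewrite -cY; lia.
apply: le_trans (_ : (\sum_(v in X) #|mts (out_nbrs arc X v)|)%N%:R <= _).
  by rewrite ler_nat; apply: card_mts_sources.
rewrite natr_sum; apply: le_trans (ler_sum _ outb) _; rewrite -mulr_sumr.
apply: le_trans (_ : b ^+ #|X| * b^-1 * b <= _); last first.
  by rewrite mulfVK // gt_eqF // b_gt0.
rewrite ler_wpM2l ?sum_weights // mulr_ge0 ?exprn_ge0 ?invr_ge0 //;
  exact: ltW b_gt0.
Qed.

End Step.

Lemma card_mts_bound X : #|mts X|%:R <= b ^+ #|X|.
Proof.
have [n] := ubnP #|X|; elim: n X => // n IHn X ltXn.
have IH Y : (#|Y| < #|X|)%N -> #|mts Y|%:R <= b ^+ #|Y|.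
  by move=> YX; apply: IHn; apply: leq_trans YX _.
case: (eqVneq X set0) => [-> | X0].
  rewrite cards0 expr0 -[1]/(1%:R) ler_nat -(cards1 (set0 : {set V})).
  apply: subset_leq_card; apply/subsetP => S; rewrite inE => /and3P[].
  by rewrite subset0 inE.
case: (boolP [exists v in X, #|in_nbrs X v| <= 1]%N); last first.
  move=> /exists_inPn deg; apply: bound_indeg_ge2 => // v /deg.
  by rewrite -ltnNge.
case/exists_inP => v Xv; rewrite leq_eqVlt ltnS leqn0.
case/orP => [/cards1P[u inv]|]; first exact: bound_unique_in_nbr Xv inv.
(* In-degree 0: [v] is a source of [X] and can be removed. *)
rewrite cards_eq0 => /eqP inv.
have ltX : (#|X :\ v| < #|X|)%N by rewrite (cardsD1 v X) Xv.
apply: le_trans (_ : #|mts (X :\ v)|%:R <= _).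
  rewrite ler_nat; apply: card_mts_source => //.
  apply/dominatesP => _ y /set1P ->; rewrite !inE => /andP[yv Xy].
  apply: contraT => nvy; have : y \in in_nbrs X v.
    by rewrite inE Xy (arcC T) // eq_sym.
  by rewrite inv inE.
by apply: le_trans (IH _ ltX) _; rewrite ler_bexp // ltnW.
Qed.

End Bound.

(** * Transfer to maximal transitive sets and minimal feedback vertex sets *)

Lemma maximal_transitive_sets_sub (V : finType) (arc : rel V) :
  tournament arc -> maximal_transitive_sets arc \subset mts arc setT.
Proof.
move=> T; apply/subsetP => S; rewrite inE => /asboolP[tS mS].
apply/mtsP; split=> [||v _ tv]; first exact: subsetT.
  exact/(acyclic_induced T).
by apply: contraT => /mS[]; apply/(acyclic_induced T).
Qed.

(** If a vertex v of F could be added to the complement of F, then [F :\ v] would be a smaller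
    feedback vertex set. *)
Lemma minimal_feedback_vertex_sets_sub (V : finType) (arc : rel V) :
  tournament arc ->
  minimal_feedback_vertex_sets arc \subset [set ~: S | S in mts arc setT].
Proof.
move=> T; apply/subsetP => F; rewrite inE => /asboolP[fF mF].
apply/imsetP; exists (~: F); last by rewrite setCK.
apply/mtsP; split=> [||v _ tv]; first exact: subsetT.
  exact/(acyclic_induced T).
rewrite inE; apply/negP => Fv; apply: (mF (F :\ v)); first exact: properD1.
by apply/(acyclic_induced T); rewrite setCD setUC.
Qed.

Local Open Scope ring_scope.

Theorem theorem1 (V : finType) (arc : rel V) :
  tournament arc -> strong arc ->
  (#|maximal_transitive_sets arc|%:R <= 1.6740%Q ^+ #|V| :> rat) /\
  (#|minimal_feedback_vertex_sets arc|%:R <= 1.6740%Q ^+ #|V| :> rat).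
Proof.
move=> T _.
have bE : 1.6740%Q = 837 / 500 by apply/eqP; vm_compute.
have bound : #|mts arc setT|%:R <= 1.6740%Q ^+ #|V| :> rat.
  by rewrite -cardsT; apply: card_mts_bound.
split; apply: le_trans bound; rewrite ler_nat.
  exact/subset_leq_card/maximal_transitive_sets_sub.
apply: leq_trans (leq_imset_card _ _).
exact/subset_leq_card/minimal_feedback_vertex_sets_sub.
Qed.
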